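(* Let $\mathcal{G}_0$ be a unit area flat metric on the $2$-torus $\mathbb{T}^2$ whose lattice of deck transformations is similar to $\mathbb{Z}\tau+\mathbb{Z}1\subset\mathbb{C}$, where $\tau$ lies in the closure of the standard fundamental domain $$D=\bigl\{ z\in\mathbb{C} : |z|>1,\ |\Re(z)|<\tfrac12,\ \Im(z)>0\bigr\}.$$ If $\tau$ is pure imaginary, then every metric $\mathcal{G}=f^2\mathcal{G}_0$ with conformal factor $f>0$ satisfies $$\operatorname{area}(\mathcal{G}) - \operatorname{sys}(\mathcal{G})^2 \;\geq\; \operatorname{Var}(f).$$
   Context: The systole $\operatorname{sys}(\mathcal{G})$ is the least $\mathcal{G}$-length of a noncontractible loop on $\mathbb{T}^2$; $\operatorname{area}(\mathcal{G})$ is the total area. A unit area flat torus $(\mathbb{T}^2,\mathcal{G}_0)$ is identified with $\mathbb{R}^2/L$ with the metric $dx^2+dy^2$, where $L\subset\mathbb{R}^2=\mathbb{C}$ is a lattice of coarea $1$ (the lattice of deck transformations). The condition that $\tau$ is pure imaginary means that $L$ is a rectangular lattice. The variance is taken with respect to the probability measure $\mu$ on $\mathbb{T}^2$ given by the area measure of $\mathcal{G}_0$: $\operatorname{Var}(f)=\int_{\mathbb{T}^2}(f-m)^2\,d\mu$, where $m=\int_{\mathbb{T}^2} f\,d\mu$. *)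

(* Defs.v *)
From HB Require Import structures.
From mathcomp Require Import all_boot all_order all_algebra generic_quotient.
From mathcomp Require Import ring lra.
From mathcomp Require Import all_classical all_reals all_analysis.
From mathcomp Require Import measurable_realfun.

Set Implicit Arguments.
Unset Strict Implicit.
Unset Printing Implicit Defensive.

Import Order.TTheory GRing.Theory Num.Theory.
Import numFieldNormedType.Exports.

Local Open Scope classical_set_scope.
Local Open Scope quotient_scope.
Local Open Scope ring_scope.

(* The Euclidean plane, also in the role of the complex plane: the pair (x, y)
   stands for x + iy. *)
Notation plane R := (R * R)%type (only parsing).

Section Plane.
Context {R : realType}.
Implicit Types (u v z : plane R).

(* The norm that the library puts on a product type is the max norm, hence this
   separate Euclidean norm; both induce the same topology. *)
Definition enorm z : R := Num.sqrt (z.1 ^+ 2 + z.2 ^+ 2).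

Definition det2 u v : R := u.1 * v.2 - u.2 * v.1.

Definition lincomb u v (a b : R) : plane R :=
  (a * u.1 + b * v.1, a * u.2 + b * v.2).

Definition Zspan u v : set (plane R) :=
  [set z | exists m n : int, z = lincomb u v m%:~R n%:~R].

Definition parallelogram u v : set (plane R) :=
  [set z | exists a b : R, [/\ 0 <= a < 1, 0 <= b < 1 & z = lincomb u v a b]].

Definition fundamental_domain : set (plane R) :=
  [set z | [/\ 1 < enorm z, `|z.1| < 1 / 2 & 0 < z.2]].

(* S is a linear similarity of the plane: a rotation or reflection followed by
   the scaling by r. *)
Definition plane_similar (A B : set (plane R)) : Prop :=
  exists (r : R) (S : {linear (plane R) -> (plane R)}),
    [/\ 0 < r, forall z, enorm (S z) = r * enorm z & A = S @` B].

Lemma parallelogramE u v : det2 u v != 0 ->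
  parallelogram u v = (fun z => det2 z v / det2 u v) @^-1` `[0, 1[ `&`
                      (fun z => det2 u z / det2 u v) @^-1` `[0, 1[.
Proof.
move=> d0; apply/seteqP; split => [z [a [b [a01 b01 ->]]]|z []].
  have dE1 : det2 (lincomb u v a b) v = a * det2 u v.
    by rewrite /det2 /=; ring.
  have dE2 : det2 u (lincomb u v a b) = b * det2 u v.
    by rewrite /det2 /=; ring.
  by split; rewrite /= in_itv /= ?dE1 ?dE2 mulfK.
rewrite /= !in_itv /= => a01 b01.
exists (det2 z v / det2 u v), (det2 u z / det2 u v); split => //.
by case: z {a01 b01} => x y; congr (_, _); move: d0; rewrite /det2 /= => d0;
  field.
Qed.

Lemma measurable_parallelogram u v : det2 u v != 0 ->
  measurable (parallelogram u v).
Proof.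
move=> /parallelogramE ->; apply: measurableI.
  rewrite -[X in measurable X]setTI; apply: (_ : measurable_fun setT _) => //.
  apply: measurable_funM => //; apply: measurable_funB;
    by apply: measurable_funM => //; exact: measurable_snd || exact: measurable_fst.
rewrite -[X in measurable X]setTI; apply: (_ : measurable_fun setT _) => //.
apply: measurable_funM => //; apply: measurable_funB;
  by apply: measurable_funM => //; exact: measurable_snd || exact: measurable_fst.
Qed.

Lemma open_measurable_plane (U : set (plane R)) : open U -> measurable U.
Proof.
move=> oU.
pose Q (q : rat * rat * (rat * rat)) : set (plane R) :=
  `]ratr q.1.1, ratr q.1.2[ `*` `]ratr q.2.1, ratr q.2.2[.
pose F q := if pselect (Q q `<=` U) then Q q else set0.
have -> : U = \bigcup_q F q.
  apply/seteqP; split => [[x y] Uxy|z [q _]]; last first.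
    by rewrite /F; case: pselect => // h /h.
  have /nbhs_ballP[e /= e0 eU] : nbhs (x, y) U by exact: open_nbhs_nbhs.
  have rat_between (a b : R) : a < b -> exists q : rat, a < ratr q < b.
    by move=> /rat_in_itvoo[q]; rewrite in_itv /=; exists q.
  have [|a1 /andP[a11 a12]] := rat_between (x - e) x.
    by rewrite ltrBlDr ltrDl.
  have [|a2 /andP[a21 a22]] := rat_between x (x + e); first by rewrite ltrDl.
  have [|b1 /andP[b11 b12]] := rat_between (y - e) y.
    by rewrite ltrBlDr ltrDl.
  have [|b2 /andP[b21 b22]] := rat_between y (y + e); first by rewrite ltrDl.
  have QU : Q ((a1, a2), (b1, b2)) `<=` U.
    move=> [x' y'] []; rewrite /= !in_itv /= => /andP[? ?] /andP[? ?].
    by apply: eU; split; rewrite /ball /= ltr_distlC; apply/andP; split; lra.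
  exists ((a1, a2), (b1, b2)) => //; rewrite /F; case: pselect => [?|//].
  by split; rewrite /= in_itv /=; apply/andP; split.
apply: countable_bigcupT_measurable => // q; rewrite /F.
case: pselect => [?|?] /=; last exact: measurable0.
by apply: measurableX; exact: measurable_itv.
Qed.

End Plane.

Record lattice (R : realType) := Lattice {
  basis1 : plane R;
  basis2 : plane R;
  basis_free : det2 basis1 basis2 != 0 }.

Section Torus.
Context {R : realType}.
Variable L : lattice R.

Definition lattice_set : set (plane R) := Zspan (basis1 L) (basis2 L).

Definition coarea : R := `|det2 (basis1 L) (basis2 L)|.

Definition torus_rel : rel (plane R) := fun z w => `[< lattice_set (z - w) >].

Lemma torus_rel_equiv : equiv_class_of torus_rel.
Proof.
split=> [z|z w|w z t].
- by apply/asboolP; exists 0, 0; rewrite /lincomb subrr !mul0r addr0.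
- have sym a b : torus_rel a b -> torus_rel b a.
    move=> /asboolP[m [n abE]]; apply/asboolP; exists (- m), (- n).
    by rewrite -opprB abE /lincomb !rmorphN /= !mulNr -!opprD.
  by apply/idP/idP; exact: sym.
- move=> /asboolP[m [n zwE]] /asboolP[m' [n' wtE]].
  apply/asboolP; exists (m + m'), (n + n').
  rewrite -(subrK w z) -addrA zwE wtE /lincomb !rmorphD /=.
  by congr (_, _) => /=; ring.
Qed.

Canonical torus_equiv := EquivRelPack torus_rel_equiv.

Definition torus : Type := quotient_topology {eq_quot torus_equiv}.

HB.instance Definition _ := Topological.on torus.

Definition torus_proj (z : plane R) : torus := \pi_({eq_quot torus_equiv}) z.

HB.instance Definition _ := isPointed.Build torus (torus_proj 0).

Lemma projP z w : torus_proj z = torus_proj w <-> lattice_set (z - w).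
Proof.
split=> [/eqmodP/asboolP//|zw]; exact/eqmodP/asboolP.
Qed.

Lemma continuous_proj : continuous torus_proj.
Proof. exact: pi_continuous. Qed.

Definition borel_torus := g_sigma_algebraType (@open torus).

HB.instance Definition _ := Measurable.on borel_torus.

Lemma measurable_proj : measurable_fun setT (torus_proj : plane R -> borel_torus).
Proof.
apply: (measurability (@open torus : set (set borel_torus))) => //.
move=> _ [U oU <-]; rewrite setTI; apply: open_measurable_plane.
by move/continuousP: continuous_proj; exact.
Qed.

HB.instance Definition _ :=
  isMeasurableFun.Build _ _ _ _ (torus_proj : plane R -> borel_torus) measurable_proj.

(* The area measure of the flat metric dx^2 + dy^2 on R^2/L: a Borel set has the
   Lebesgue measure of the part of its preimage in a fundamental
   parallelogram. *)
Definition torus_area : set borel_torus -> \bar R :=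
  pushforward (mrestr (lebesgue_measure \x lebesgue_measure)%E
                 (measurable_parallelogram (basis_free L)))
              (torus_proj : plane R -> borel_torus).

Let torus_area0 : torus_area set0 = 0%E.
Proof. by apply: measure0; exact: measurable_proj. Qed.

Let torus_area_ge0 A : (0 <= torus_area A)%E.
Proof. by apply: measure_ge0; exact: measurable_proj. Qed.

Let torus_area_sigma_additive : semi_sigma_additive torus_area.
Proof. by apply: measure_semi_sigma_additive; exact: measurable_proj. Qed.

HB.instance Definition _ := isMeasure.Build _ _ _ torus_area
  torus_area0 torus_area_ge0 torus_area_sigma_additive.

End Torus.
Arguments torus_area {R} L _.

(* g is a loop on [0, 1]; its values outside [0, 1] are irrelevant. The
   null-homotopy is free: the base point may move. *)
Definition contractible_loop {R : realType} {T : topologicalType} (g : R -> T) :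
    Prop :=
  exists (H : R * R -> T) (p : T),
    [/\ {within `[0, 1] `*` `[0, 1], continuous H},
        {in `[0, 1], forall t, H (0, t) = g t},
        {in `[0, 1], forall t, H (1, t) = p} &
        {in `[0, 1], forall s, H (s, 0) = H (s, 1)}].

(* Piecewise C^1 on [0, 1], the pieces being cut at the nodes s, whose last item
   is 1. A piece is C^1 up to its end points iff it extends to a C^1 map on the
   whole line. *)
Definition piecewise_C1 {R : realType} (c : R -> plane R) : Prop :=
  exists s : seq R,
    [/\ path <%R 0 s, last 0 s = 1 &
        forall i, (i < size s)%N -> exists g : R -> plane R,
          [/\ forall t, derivable g t 1, continuous (derive1 g) &
              {in `[nth 0 (0 :: s) i, nth 0 s i], c =1 g}]].

Section ConformalMetric.
Context {R : realType}.
Variable L : lattice R.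

(* A piecewise C^1 loop on R^2/L is handled through a lift c to the plane,
   which is a path that need not be closed. *)
Definition noncontractible_loop (c : R -> plane R) : Prop :=
  [/\ piecewise_C1 c, torus_proj L (c 0) = torus_proj L (c 1) &
      ~ contractible_loop (torus_proj L \o c)].

(* From here on, f is the conformal factor of the metric f^2 (dx^2 + dy^2). *)
Variable f : torus L -> R.

(* At the finitely many break points derive1 is a junk value, which does not
   affect the integral. *)
Definition loop_length (c : R -> plane R) : R :=
  \int[lebesgue_measure]_(t in `[0, 1]) (f (torus_proj L (c t)) * enorm (derive1 c t)).

Definition sys : R := inf [set loop_length c | c in noncontractible_loop].

Definition area : R := \int[torus_area L]_x (f x ^+ 2).

Definition torus_mean : R := \int[torus_area L]_x f x.

Definition torus_variance : R := \int[torus_area L]_x ((f x - torus_mean) ^+ 2).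

End ConformalMetric.

(* Main.v *)
(* The mean [m] of the conformal factor satisfies [area - Var = m^2], so the
   claim is [sys <= m]. Let [v] be a nonzero lattice vector. The straight loops
   [t |-> z + t v] are noncontractible, hence at least [sys] long; averaging
   their lengths over all starting points [z] yields [sys <= |v| m], because the
   area measure of the torus is invariant under translations. In a rectangular
   lattice of coarea 1 the sides [r] and [r * tau.2 >= r] of a fundamental
   rectangle satisfy [r^2 * tau.2 = 1], so the shorter one is a vector [v] with
   [|v| = r <= 1]. *)

Require Import Defs.
From HB Require Import structures.
From mathcomp Require Import all_boot all_order all_algebra.
From mathcomp Require Import ring lra.
From mathcomp Require Import all_classical all_reals all_analysis.
From mathcomp Require Import measurable_realfun.

Set Implicit Arguments.
Unset Strict Implicit.
Unset Printing Implicit Defensive.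

Import Order.TTheory GRing.Theory Num.Theory.
Import numFieldNormedType.Exports.

Local Open Scope classical_set_scope.
Local Open Scope ring_scope.

(** * Lebesgue measure and linear maps of the plane *)

Section linear_maps.
Context {R : realType}.
Local Notation mu := (@lebesgue_measure R).
Implicit Types (c d k : R) (u v : R * R).

Lemma measurable_affine d k :
  measurable_fun setT
    (fun x : measurableTypeR R => d * x + k : measurableTypeR R).
Proof. by apply: measurable_funD => //; exact: measurable_funM. Qed.

(** The pushforward of [mu] under the affine map, scaled by [|d|], gives []a, b]] the mass [b - a],
    so uniqueness of Lebesgue measure identifies it with [mu]. *)
Lemma lebesgue_measure_affine d k (A : set R) : d != 0 -> measurable A ->
  mu ((fun x => d * x + k) @^-1` A) = ((`|d|^-1)%:E * mu A)%E.
Proof.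
move=> d0 mA; have nd0 : 0 < `|d| by rewrite normr_gt0.
pose aff : measurableTypeR R -> measurableTypeR R := fun x => d * x + k.
suff /(_ _ mA) -> : forall X : set R, measurable X ->
    mu X = ((`|d|)%:E * mu (aff @^-1` X))%E.
  by rewrite muleA -EFinM mulVf ?gt_eqF// mul1e.
pose nu : {measure set _ -> \bar R} :=
  mscale (NngNum (ltW nd0)) (pushforward mu aff).
have maff : measurable_fun setT aff by exact: measurable_affine.
move=> X mX; rewrite -[RHS]/(nu maff X).
apply: lebesgue_measure_unique => // _ [[a b]] _ <- /=.
rewrite /nu /mscale /= /pushforward.
have [dneg|dpos|d00] := ltgtP d 0; last by rewrite d00 eqxx in d0.
(* A negative slope exchanges the open and the closed end, which leaves the length unchanged. *)
- have -> : aff @^-1` `]a, b] = `[(b - k) / d, (a - k) / d[%classic.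
    apply/seteqP; split => x /=; rewrite !in_itv /= /aff => /andP[];
    rewrite ?ler_ndivrMr ?ltr_ndivlMr //; move=> ? ?; apply/andP; split; lra.
  rewrite !lebesgue_measure_itv/= !lte_fin ltr_nM2r ?invr_lt0 //.
  rewrite ltrBlDr subrK; case: ifP; rewrite ?mule0// => _.
  rewrite -EFinD ltr0_norm// -EFinM; congr EFin; field.
  by rewrite lt_eqF.
- have -> : aff @^-1` `]a, b] = `](a - k) / d, (b - k) / d]%classic.
    apply/seteqP; split => x /=; rewrite !in_itv /= /aff => /andP[];
    rewrite ?ler_pdivlMr ?ltr_pdivrMr //; move=> ? ?; apply/andP; split; lra.
  rewrite !lebesgue_measure_itv/= !lte_fin ltr_pM2r ?invr_gt0 //.
  rewrite ltrBlDr subrK; case: ifP; rewrite ?mule0// => _.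
  rewrite -EFinD gtr0_norm// -EFinM; congr EFin; field.
  by rewrite gt_eqF.
Qed.

Local Notation mu2 := (mu \x mu)%E.
(* Lebesgue measure lives on [measurableTypeR R], which is convertible to [R]
   but carries a syntactically different measurable structure. *)
Local Notation mplane := (measurableTypeR R * measurableTypeR R)%type.

(* An invertible linear map [T] satisfies this with [c = |det T|^-1]. *)
Definition scales_area (T : mplane -> mplane) c :=
  measurable_fun setT T /\
  forall B, measurable B -> mu2 (T @^-1` B) = (c%:E * mu2 B)%E.

Lemma scales_area_comp T1 T2 c1 c2 :
  scales_area T1 c1 -> scales_area T2 c2 -> scales_area (T1 \o T2) (c1 * c2).
Proof.
move=> [m1 h1] [m2 h2]; split; first exact: measurableT_comp.
move=> B mB; rewrite comp_preimage h2; last first.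
  by rewrite -[X in measurable X]setTI; exact: m1.
by rewrite h1// muleA -EFinM mulrC.
Qed.

(** A product measure is determined by its values on rectangles, and there the claim is
    commutativity of multiplication. *)
Lemma scales_area_swap : scales_area (fun z => (z.2, z.1)) 1.
Proof.
have ms : measurable_fun setT (fun z : mplane => (z.2, z.1) : mplane).
  exact: measurable_swap.
split=> // B mB; rewrite mul1e.
pose nu : {measure set _ -> \bar R} :=
  pushforward mu2 (fun z : mplane => (z.2, z.1) : mplane).
rewrite -[LHS]/(nu ms B).
apply/esym; apply: (product_measure_unique (m' := nu ms)) => // A1 A2 mA1 mA2.
rewrite /nu/= /pushforward.
rewrite [X in mu2 X](_ : _ = A2 `*` A1).
  by rewrite product_measure1E// muleC.
by apply/seteqP; split => -[x y] [].
Qed.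

(** On each vertical line the map is affine with slope [d], so every section shrinks by [|d|^-1];
    the area is the integral of the section lengths. *)
Lemma scales_area_affine2 d k : d != 0 ->
  scales_area (fun z => (z.1, d * z.2 + k * z.1)) `|d|^-1.
Proof.
move=> d0; split.
  apply/measurable_fun_pairP; split => //=; first exact: measurable_fst.
  by apply: measurable_funD; apply: measurable_funM.
move=> B mB; rewrite /product_measure1 -ge0_integralZl//; last first.
  exact: (measurable_fun_xsection mu).
apply: eq_integral => x _ /=.
rewrite -(lebesgue_measure_affine (k * x))//; last exact: measurable_xsection.
Qed.

(* Swaps and the maps [(x, y) |-> (x, d y + k x)] generate the linear group. *)
Lemma scales_area_lincomb u v : det2 u v != 0 ->
  scales_area (fun z => lincomb u v z.1 z.2) `|det2 u v|^-1.
Proof.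
(* The factorization below has pivot [u.1]. If it vanishes, [v.1] does not, and the two columns are
   swapped. *)
wlog u10 : u v / u.1 != 0 => [hw d0|d0].
  have [u10|] := eqVneq u.1 0; last by move=> ?; exact: hw.
  have v10 : v.1 != 0.
    by apply: contraNneq d0 => v10; rewrite /det2 u10 v10 !(mul0r, mulr0) subrr.
  have dE : det2 v u = - det2 u v by rewrite /det2; ring.
  have dvu : det2 v u != 0 by rewrite dE oppr_eq0.
  have := scales_area_comp (hw _ _ v10 dvu) scales_area_swap.
  rewrite dE normrN mulr1; congr scales_area; apply/funext => z.
  by rewrite /lincomb /=; congr pair; rewrite addrC.
have d10 : det2 u v / u.1 != 0 by rewrite mulf_neq0// invr_eq0.
have i10 : 1 != 0 :> R := oner_neq0 R.
(* LU factorization of the matrix with columns [u] and [v]: a lower shear, an upper triangular map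
   (conjugated by swaps), and a scaling of the second coordinate by [det2 u v / u.1]. *)
have := scales_area_comp (scales_area_affine2 (u.2 / u.1) i10)
  (scales_area_comp scales_area_swap
  (scales_area_comp (scales_area_affine2 (v.1 / (det2 u v / u.1)) u10)
  (scales_area_comp scales_area_swap (scales_area_affine2 0 d10)))).
rewrite normr1 invr1 !mul1r -invfM -normrM [u.1 * _]mulrC divfK//.
congr scales_area; apply/funext => -[a b].
case: u v u10 d0 {d10} => u1 u2 [v1 v2]; rewrite /det2 /lincomb /= => u10 d0.
by congr pair; field; rewrite ?u10 ?d0.
Qed.

End linear_maps.

Lemma ge0_integral_mrestr d (T : measurableType d) (R : realType)
    (mu : {measure set T -> \bar R}) (D : set T) (mD : measurable D)
    (f : T -> \bar R) :
  measurable_fun setT f -> (forall x, 0 <= f x)%E ->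
  (\int[mrestr mu mD]_x f x = \int[mu]_(x in D) f x)%E.
Proof.
move=> mf f0; rewrite -(setUv D) ge0_integral_setU//; last 3 first.
- exact: measurableC.
- by rewrite setUv.
- by rewrite disj_set2E setICr.
rewrite [X in (_ + X)%E](_ : _ = 0%E) ?adde0.
  by apply: eq_measure_integral => A mA AD; rewrite /= /mrestr setIidl.
rewrite -[RHS](@integral_measure_zero _ T R (~` D) f).
apply: eq_measure_integral => A mA AD; rewrite /= /mrestr /mzero.
by rewrite (_ : A `&` D = set0) ?measure0// -subset0 => x [/AD].
Qed.

(** * The area of the torus in lattice coordinates *)

Section torus_integral.
Context {R : realType}.
Local Notation mu := (@lebesgue_measure R).
Local Notation mu2 := (mu \x mu)%E.
Local Notation mplane := (measurableTypeR R * measurableTypeR R)%type.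

Definition unit_square : set mplane := `[0, 1[ `*` `[0, 1[.

Lemma unit_square_area : mu2 unit_square = 1%E.
Proof.
transitivity (mu `[0%R, 1%R[ * mu `[0%R, 1%R[)%E.
  by apply: product_measure1E; exact: measurable_itv.
by rewrite !lebesgue_measure_itv /= lte_fin ltr01 -EFinD subr0 mule1.
Qed.

Lemma preimage_parallelogram (u v : R * R) : det2 u v != 0 ->
  (fun z : mplane => lincomb u v z.1 z.2) @^-1` parallelogram u v = unit_square.
Proof.
move=> d0; apply/seteqP; split => -[x y]; last first.
  by rewrite /unit_square/= !in_itv /= => -[x01 y01]; exists x, y.
rewrite parallelogramE //.
case; rewrite /preimage /= !in_itv /=.
have -> : det2 (lincomb u v x y) v = x * det2 u v by rewrite /det2 /=; ring.
have -> : det2 u (lincomb u v x y) = y * det2 u v by rewrite /det2 /=; ring.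
by rewrite !mulfK// => x01 y01; split; rewrite /= in_itv.
Qed.

(** Change of variables: [lincomb] carries the unit square onto the fundamental parallelogram, with
    Jacobian [coarea L]. *)
Lemma torus_integral (L : lattice R) (h : torus L -> \bar R) :
  measurable_fun setT (h : borel_torus L -> \bar R) -> (forall x, 0 <= h x)%E ->
  (\int[torus_area L]_x h x =
   (coarea L)%:E * \int[mu2]_(z in unit_square)
     h (torus_proj L (lincomb (basis1 L) (basis2 L) z.1 z.2)))%E.
Proof.
move=> mh h0; set b1 := basis1 L; set b2 := basis2 L.
have D0 : det2 b1 b2 != 0 by exact: (Defs.basis_free L).
have mp : measurable_fun setT (torus_proj L : mplane -> borel_torus L).
  exact: measurable_proj.
have P : measurable (parallelogram b1 b2 : set mplane).
  exact: measurable_parallelogram.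
pose g (z : mplane) := h (torus_proj L z).
have mg : measurable_fun setT g by exact: measurableT_comp mh mp.
transitivity (\int[mu2]_(z in parallelogram b1 b2) g z)%E.
  have H := @ge0_integral_pushforward _ _ _ (borel_torus L) R _ mp
    (mrestr mu2 P) setT h measurableT mh (fun x _ => h0 x).
  etransitivity; first exact: H.
  by rewrite preimage_setT; exact: (ge0_integral_mrestr _ P mg (fun x => h0 _)).
have [mT hT] := scales_area_lincomb D0.
set T : mplane -> mplane := fun _ => _ in mT hT.
pose nu : {measure set _ -> \bar R} :=
  mscale (NngNum (normr_ge0 (det2 b1 b2))) (pushforward mu2 T).
(* [T] divides areas of preimages by [|det2 b1 b2|], so the rescaled pushforward [nu] is [mu2]
   itself. *)
transitivity (\int[nu mT]_(z in parallelogram b1 b2) g z)%E.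
  apply: eq_measure_integral => A mA _.
  rewrite -[RHS]/(`|det2 b1 b2|%:E * mu2 (T @^-1` A))%E.
  by rewrite (hT A mA) muleA -EFinM divff ?mul1e// normr_eq0.
have gge0 z : parallelogram b1 b2 z -> (0 <= g z)%E by move=> _; exact: h0.
rewrite (ge0_integral_mscale _ P (NngNum (normr_ge0 (det2 b1 b2)))
  (measurable_funTS mg) gge0).
rewrite (ge0_integral_pushforward mT mu2 P (measurable_funTS mg)
  (fun x _ => h0 _)).
by rewrite (preimage_parallelogram D0).
Qed.

End torus_integral.

(** * Integrals of periodic functions *)

Section periodic.
Context {R : realType}.
Local Notation mu := (@lebesgue_measure R).
Local Notation mline := (measurableTypeR R).

Lemma measurable_shift (a : R) :
  measurable_fun setT (fun x : mline => a + x : mline).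
Proof. by apply: measurable_funD. Qed.

Lemma ge0_integral_shift (g : mline -> \bar R) (D : set mline) (a : R) :
  measurable D -> measurable_fun setT g -> (forall x, 0 <= g x)%E ->
  (\int[mu]_(x in +%R a @^-1` D) g (a + x)%R = \int[mu]_(x in D) g x)%E.
Proof.
move=> mD mg g0.
have ma := measurable_shift a.
have <- := ge0_integral_pushforward ma mu mD (measurable_funTS mg)
  (fun x _ => g0 x).
apply: eq_measure_integral => A mA _.
have := lebesgue_measure_affine a (oner_neq0 R) mA.
rewrite normr1 invr1 mul1e => muA; rewrite -[RHS]/(mu A) -muA.
rewrite -[LHS]/(mu (+%R a @^-1` A)); congr (mu _).
by apply/funext => x /=; rewrite mul1r addrC.
Qed.

Lemma periodic_int (T : Type) (g : R -> T) : (forall x, g (1 + x) = g x) ->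
  forall (n : int) x, g (n%:~R + x) = g x.
Proof.
move=> g1.
have gn (n : nat) x : g (n%:R + x) = g x.
  by elim: n => [|n IH]; rewrite ?add0r// mulrS -addrA g1.
case=> n x; first exact: gn.
by rewrite NegzE mulrNz -[LHS](gn n.+1) addrA subrr add0r.
Qed.

Lemma shift_preimage_itvco (a b c : R) :
  +%R a @^-1` `[b, c[ = `[b - a, c - a[%classic.
Proof.
by apply/seteqP; split => x /=; rewrite !in_itv /= lerBlDl ltrBrDl.
Qed.

Lemma ge0_integral_periodic (g : mline -> \bar R) (a : R) :
  measurable_fun setT g -> (forall x, 0 <= g x)%E ->
  (forall x, g (1 + x) = g x) ->
  (\int[mu]_(x in `[0%R, 1%R[) g (a + x)%R = \int[mu]_(x in `[0%R, 1%R[) g x)%E.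
Proof.
move=> mg g0 g1.
(* By periodicity only the fractional part [b] of the shift matters. *)
pose b := a - (Num.floor a)%:~R.
have [b0 b1] : 0 <= b /\ b < 1.
  have /andP[h1 h2] := floor_itv a.
  split; rewrite /b ?subr_ge0// ltrBlDr addrC.
  by move: h2; rewrite intrD.
have gE x : g (a + x) = g (b + x).
  rewrite -(periodic_int g1 (Num.floor a) (b + x)) addrA.
  by rewrite /b addrCA subrr addr0.
under eq_integral do rewrite gE.
have mi (c d : R) : measurable (`[c, d[%classic : set mline).
  exact: measurable_itv.
have disj (c d e : R) : [disjoint `[c, d[%classic & `[d, e[%classic].
  rewrite disj_set2E; apply/eqP; rewrite -subset0 => x [].
  rewrite /= !in_itv /= => /andP[_ xd] /andP[/(lt_le_trans xd)].
  by rewrite ltxx.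
have split_itv (c d e : R) : c <= d -> d <= e ->
    (\int[mu]_(x in `[c, e[) g x =
     \int[mu]_(x in `[c, d[) g x + \int[mu]_(x in `[d, e[) g x)%E.
  move=> cd de; rewrite -ge0_integral_setU//; last exact: measurable_funTS.
  by rewrite -itv_bndbnd_setU// bnd_simp.
transitivity (\int[mu]_(x in `[b, (1 + b)%R[) g x)%E.
  rewrite -(ge0_integral_shift b (mi _ _) mg g0).
  by rewrite shift_preimage_itvco subrr addrK.
(* The part [[1, 1 + b[] of the shifted period is moved back by 1 onto [[0, b[], which completes
   [[b, 1[] to [[0, 1[]. *)
rewrite (split_itv _ 1) ?(ltW b1)// ?lerDl// [RHS](split_itv _ b)// ?(ltW b1)//.
rewrite addeC; congr (_ + _)%E.
rewrite -(ge0_integral_shift 1 (mi _ _) mg g0) shift_preimage_itvco subrr.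
rewrite addrAC subrr add0r.
by apply: eq_integral => x _; rewrite g1.
Qed.

End periodic.

(** * Tonelli's theorem on rectangles *)

Section fubini_tonelli_setX.
Local Open Scope ereal_scope.
Context d1 d2 (T1 : measurableType d1) (T2 : measurableType d2) (R : realType).
Variables (m1 : {sigma_finite_measure set T1 -> \bar R})
          (m2 : {sigma_finite_measure set T2 -> \bar R}).
Variables (A : set T1) (B : set T2) (f : T1 * T2 -> \bar R).
Hypotheses (mA : measurable A) (mB : measurable B) (mf : measurable_fun setT f).
Hypothesis f0 : forall z, 0 <= f z.

Let mfAB : measurable_fun setT (f \_ (A `*` B)).
Proof.
apply/(measurable_restrictT _ _).1; first exact: measurableX.
exact: measurable_funTS.
Qed.

Let fAB0 z : 0 <= (f \_ (A `*` B)) z.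
Proof. by apply: erestrict_ge0. Qed.

Let fABE x y : (f \_ (A `*` B)) (x, y) =
  if (x \in A) && (y \in B) then f (x, y) else 0.
Proof. by rewrite patchE in_setX. Qed.

(** Tonelli on the whole product, applied to [f] extended by zero. *)
Lemma fubini_tonelli1_setX :
  \int[m1 \x m2]_(z in A `*` B) f z =
  \int[m1]_(x in A) \int[m2]_(y in B) f (x, y).
Proof.
rewrite integral_mkcond fubini_tonelli1// [RHS]integral_mkcond.
apply: eq_integral => x _; rewrite /fubini_F patchE.
under eq_integral do rewrite fABE.
case: ifPn => xA /=; last by rewrite integral0.
by rewrite [RHS]integral_mkcond; apply: eq_integral => y _; rewrite patchE.
Qed.

Lemma fubini_tonelli2_setX :
  \int[m1 \x m2]_(z in A `*` B) f z =
  \int[m2]_(y in B) \int[m1]_(x in A) f (x, y).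
Proof.
rewrite integral_mkcond fubini_tonelli2// [RHS]integral_mkcond.
apply: eq_integral => y _; rewrite /fubini_G patchE.
under eq_integral do rewrite fABE andbC.
case: ifPn => yB /=; last by rewrite integral0.
by rewrite [RHS]integral_mkcond; apply: eq_integral => x _; rewrite patchE.
Qed.

End fubini_tonelli_setX.

Lemma measurable_fubini_tonelli_setX d1 d2 (T1 : measurableType d1)
    (T2 : measurableType d2) (R : realType)
    (m2 : {sigma_finite_measure set T2 -> \bar R}) (B : set T2)
    (f : T1 * T2 -> \bar R) :
  measurable B -> measurable_fun setT f -> (forall z, 0 <= f z)%E ->
  measurable_fun setT (fun x => \int[m2]_(y in B) f (x, y))%E.
Proof.
move=> mB mf f0; rewrite [X in measurable_fun _ X](_ : _ =
    fubini_F m2 (f \_ (setT `*` B))).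
  apply: measurable_fun_fubini_tonelli_F; last first.
    by move=> z; exact: erestrict_ge0.
  apply/(measurable_restrictT _ _).1; first exact: measurableX.
  exact: measurable_funTS.
apply/funext => x; rewrite /fubini_F [LHS]integral_mkcond.
by apply: eq_integral => y _; rewrite !patchE in_setX in_setT.
Qed.

(** * Doubly periodic functions on the plane *)

Section periodic2.
Context {R : realType}.
Local Notation mu := (@lebesgue_measure R).
Local Notation mu2 := (mu \x mu)%E.
Local Notation mline := (measurableTypeR R).
Local Notation mplane := (measurableTypeR R * measurableTypeR R)%type.

(** The squares of an exhausting sequence cover the plane because that sequence is increasing: both
    coordinates of a point lie in a common [F n]. *)
Lemma lebesgue_plane_sigma_finite :
  sigma_finite setT (mu2 : set mplane -> \bar R).
Proof.
have /sigma_finiteP[F [TF ndF Foo]] := sigma_finiteT mu.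
exists (fun n => F n `*` F n) => [|n]; last first.
  have [mFn Fnoo] := Foo n; split; first exact: measurableX.
  rewrite [ltLHS](_ : _ = (mu (F n) * mu (F n))%E).
    by rewrite lte_mul_pinfty// ge0_fin_numE.
  exact: product_measure1E.
rewrite -setXTT TF; apply/seteqP; split => -[x y] /=.
  move=> [[n _ Fnx] [k _ Fky]]; exists (maxn n k) => //; split => /=.
    by move: x Fnx; exact/subsetPset/ndF/leq_maxl.
  by move: y Fky; exact/subsetPset/ndF/leq_maxr.
by move=> [n _ [Fnx Fny]]; split; exists n.
Qed.

(* An alias, because the library infers sigma-finiteness of a product measure
   only from finiteness of its factors. *)
Definition lebesgue_plane : set mplane -> \bar R := mu2.

HB.instance Definition _ := Measure.copy lebesgue_plane mu2.

HB.instance Definition _ := Measure_isSigmaFinite.Build _ _ _ lebesgue_plane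
  lebesgue_plane_sigma_finite.

Lemma measurable_shift2 (a b : R) :
  measurable_fun setT (fun z : mplane => (a + z.1, b + z.2) : mplane).
Proof.
apply/measurable_fun_pairP; split.
  exact: (measurableT_comp (measurable_shift a) measurable_fst).
exact: (measurableT_comp (measurable_shift b) measurable_snd).
Qed.

(** Tonelli reduces this to one-dimensional shift invariance, in [y] for the inner integral and then
    in [x]. *)
Lemma ge0_integral_periodic2 (G : mplane -> \bar R) (a b : R) :
  measurable_fun setT G -> (forall z, 0 <= G z)%E ->
  (forall x y, G (1 + x, y) = G (x, y)) ->
  (forall x y, G (x, 1 + y) = G (x, y)) ->
  (\int[mu2]_(z in unit_square) G ((a + z.1)%R, (b + z.2)%R) =
   \int[mu2]_(z in unit_square) G z)%E.
Proof.
move=> mG G0 Gx Gy.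
have mI : measurable (`[0, 1[%classic : set mline) by exact: measurable_itv.
have mGab := measurableT_comp mG (measurable_shift2 a b).
have mGx x : measurable_fun setT (fun y : mline => G (x, y)).
  exact: measurable_fun_pair2.
have -> := fubini_tonelli1_setX mu mu mI mI mGab (fun z => G0 _).
have -> := fubini_tonelli1_setX mu mu mI mI mG G0.
pose g (x : mline) := (\int[mu]_(y in `[0%R, 1%R[) G (x, y))%E.
transitivity (\int[mu]_(x in `[0%R, 1%R[) g (a + x)%R)%E.
  apply: eq_integral => x _.
  apply: (ge0_integral_periodic b (mGx (a + x)%R)) => // y.
apply: (ge0_integral_periodic a) => [|x|x].
- exact: (measurable_fubini_tonelli_setX mu mI mG G0).
- exact: integral_ge0.
- by apply: eq_integral => y _; rewrite Gx.
Qed.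

End periodic2.

(** * Noncontractible lines *)

Section signed_frac.
Context {R : realType}.
Implicit Types x y r : R.

(* The representative of [x] modulo 1 in [-1/2, 1/2). *)
Definition sfrac x : R := x - (Num.floor (x + 2^-1))%:~R.

Lemma sfrac_int x : x - sfrac x \is a Num.int.
Proof. by rewrite /sfrac opprB addrC subrK intr_int. Qed.

Lemma sfrac_eq x y : x - y \is a Num.int -> sfrac x = sfrac y.
Proof.
move=> /intrP[n xyn]; have -> : x = y + n%:~R by rewrite -xyn addrC subrK.
rewrite /sfrac [y + _ + 2^-1]addrAC floorDrz ?intr_int// intrKfloor intrD; ring.
Qed.

Lemma sfrac_small x : `|x| < 2^-1 -> sfrac x = x.
Proof.
move=> x2; rewrite /sfrac (_ : Num.floor _ = 0) ?subr0//.
apply: floor_def; move: x2; rewrite ltr_norml => /andP[? ?].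
by apply/andP; split; lra.
Qed.

Lemma int_norm_lt1 x : x \is a Num.int -> `|x| < 1 -> x = 0.
Proof.
move=> xi x1; apply/eqP; apply: contraLR x1 => x0.
by rewrite -leNgt norm_intr_ge1.
Qed.

(** [sfrac] jumps only where its absolute value is 1/2, and the bound on [r] keeps the set away from
    these points. *)
Lemma open_sfrac r : r <= 2^-1 -> open [set x | `|sfrac x| < r].
Proof.
move=> r2; rewrite openE => x /= xr; apply/nbhs_ballP.
exists (r - `|sfrac x|) => /=; first by rewrite subr_gt0.
move=> y; rewrite /ball /= => xy.
have yx : `|sfrac x + (y - x)| < r.
  by apply: (le_lt_trans (ler_normD _ _)); rewrite -ltrBrDl distrC.
have -> : sfrac y = sfrac x + (y - x); last exact: yx.
rewrite -(@sfrac_small (sfrac x + (y - x))); last exact: lt_le_trans r2.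
apply: sfrac_eq; rewrite [X in X \is a _](_ : _ = x - sfrac x); last by ring.
exact: sfrac_int.
Qed.

(* The winding number of a row of the grid, a sum of small increments modulo 1,
   does not depend on the row: around each cell the four increments of [h] add
   up to an integer of absolute value less than 1, hence to 0. *)
Lemma winding_homotopy (M N : nat) (h : nat -> nat -> R) :
  (forall i j, (i <= M)%N -> (j < N)%N -> `|sfrac (h i j.+1 - h i j)| < 8^-1) ->
  (forall i j, (i < M)%N -> (j <= N)%N -> `|sfrac (h i.+1 j - h i j)| < 8^-1) ->
  (forall i, (i <= M)%N -> h i N - h i 0 \is a Num.int) ->
  \sum_(j < N) sfrac (h 0 j.+1 - h 0 j) = \sum_(j < N) sfrac (h M j.+1 - h M j).
Proof.
move=> hd he hN.
pose d i j := sfrac (h i j.+1 - h i j); pose e i j := sfrac (h i.+1 j - h i j).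
suff W i : (i <= M)%N -> \sum_(j < N) d 0%N j = \sum_(j < N) d i j by exact: W.
elim: i => // i IH iM; rewrite (IH (ltnW iM)).
have cell j : (j < N)%N -> d i j = d i.+1 j - (e i j.+1 - e i j).
  move=> jN; apply/eqP; rewrite -subr_eq0; apply/eqP/int_norm_lt1.
    rewrite [X in X \is a _](_ : _ =
      ((h i.+1 j.+1 - h i.+1 j) - d i.+1 j) - ((h i j.+1 - h i j) - d i j)
      - ((h i.+1 j.+1 - h i j.+1) - e i j.+1)
      + ((h i.+1 j - h i j) - e i j)); last by ring.
    exact: (rpredD (rpredB (rpredB (sfrac_int _) (sfrac_int _)) (sfrac_int _))
      (sfrac_int _)).
  have := hd i j (ltnW iM) jN; have := hd i.+1 j iM jN.
  have := he i j iM (ltnW jN); have := he i j.+1 iM jN.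
  rewrite -/(d i j) -/(d i.+1 j) -/(e i j) -/(e i j.+1) !ltr_norml.
  move=> /andP[? ?] /andP[? ?] /andP[? ?] /andP[? ?]; apply/andP; split; lra.
rewrite (eq_bigr (fun j : 'I_N => d i.+1 j - (e i j.+1 - e i j))); last first.
  by move=> j _; exact: cell.
rewrite sumrB -(big_mkord xpredT (fun j => e i j.+1 - e i j)) telescope_sumr//.
(* Rows close up modulo 1, so the first and the last vertical increment agree. *)
suff -> : e i N = e i 0%N by rewrite subrr subr0.
apply: sfrac_eq; rewrite [X in X \is a _](_ : _ =
   (h i.+1 N - h i.+1 0) - (h i N - h i 0)); last by ring.
by rewrite rpredB ?hN// ltnW.
Qed.

End signed_frac.

Section noncontractible.
Context {R : realType}.
Variable L : lattice R.
Implicit Types z w v : R * R.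

Lemma torus_proj_surj (x : torus L) : exists z, torus_proj L z = x.
Proof. by exists (repr x); rewrite /torus_proj reprK. Qed.

Lemma open_torusP (U : set (torus L)) : open (torus_proj L @^-1` U) -> open U.
Proof. by []. Qed.

(** A Lebesgue number argument: the near-covering form of compactness, with the scale [e] tending to
    0 from the right as parameter, makes the neighbourhoods of the diagonal points uniform. *)
Lemma compact_near_diagonal (K : set (R * R)) (P : R * R -> R * R -> Prop) :
  compact K ->
  (forall x, K x -> \forall y \near x & z \near x, K y -> K z -> P y z) ->
  exists2 e : R, 0 < e & forall x y, K x -> K y -> ball x e y -> P x y.
Proof.
move=> /compact_near_coveringP/near_covering_withinP cK KP.
have /= := cK R (0 : R)^'+ (fun e x => forall y, K y -> ball x e y -> P x y) _.
case.
- move=> x Kx.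
  have [[A B] [/= /nbhs_ballP[a /= a0 aA] /nbhs_ballP[b /= b0 bB]] ABP] :=
    KP x Kx.
  (* [x'] stays within [b / 2] of [x], and [y] within [e < b / 2] of [x'], so [y] falls into [B]. *)
  exists (ball x (Num.min a (b / 2)), [set e : R | e < b / 2]) => /=.
    split; first by apply: nbhsx_ballx; rewrite lt_min a0 divr_gt0.
    exact: nbhs_right_lt (divr_gt0 b0 _).
  move=> [x' e] /= [xx' eb] Kx' y Ky x'y.
  apply: (ABP (x', y)) => //; split => /=.
    by apply: aA; apply: le_ball xx'; rewrite ge_min lexx.
  apply: bB; rewrite [b]splitr; apply: (@ball_triangle _ _ x').
    by apply: le_ball xx'; rewrite ge_min lexx orbT.
  by apply: le_ball x'y; exact: ltW.
- move=> e /= e0 he; exists (e / 2); first by rewrite divr_gt0.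
  move=> x y Kx Ky xy; apply: (he (e / 2)) => //=.
    by rewrite sub0r normrN gtr0_norm ?divr_gt0// ltr_pdivrMr// ltr_pMr// ltr1n.
  by rewrite divr_gt0.
Qed.

(* Modulo 1, the linear form [p x + q y] is a function on the torus. Its winding
   number along the line is [p * v.1 + q * v.2], and homotopies preserve it. *)
Lemma noncontractible_line (p q : R) (z0 v : R * R) :
  (forall z, lattice_set L z -> p * z.1 + q * z.2 \is a Num.int) ->
  p * v.1 + q * v.2 != 0 ->
  ~ contractible_loop (torus_proj L \o (fun t : R => z0 + t *: v)).
Proof.
pose l z := p * z.1 + q * z.2; move=> lint lv0 [H [x [cH H0 H1 Hs]]].
have lB z w : l (z - w) = l z - l w by rewrite /l /=; ring.
have cl : continuous l.
  move=> z; apply: cvgD; apply: cvgM; try exact: cvg_cst.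
    exact: cvg_fst.
  exact: cvg_snd.
(* [rep] is an arbitrary section, with no continuity; [l (rep y)] is meaningful only modulo 1, so
   [h] is used only through [sfrac]. *)
pose rep (y : torus L) := projT1 (cid (torus_proj_surj y)).
have repK y : torus_proj L (rep y) = y by rewrite /rep; case: cid.
have lrep z : l (rep (torus_proj L z)) - l z \is a Num.int.
  by rewrite -lB; apply: lint; apply/projP; rewrite repK.
pose h u := l (rep (H u)).
set K := `[0, 1] `*` `[0, 1] in cH.
have [e e0 he] : exists2 e : R, 0 < e & forall u w, K u -> K w -> ball u e w ->
    `|sfrac (h w - h u)| < 8^-1.
  apply: compact_near_diagonal.
    by apply: compact_setX; exact: segment_compact.
  move=> u Ku.
  (* Two points of [U] are each within 1/16 of [h u] modulo 1, hence within 1/8 of one another. *)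
  pose U : set (torus L) := [set y | `|sfrac (l (rep y) - h u)| < 16^-1].
  have oU : open U.
    apply: open_torusP.
    (* On the plane, [l (rep (torus_proj L z))] may be replaced by the continuous [l z], since they
       differ by an integer. *)
    rewrite [X in open X](_ : _ =
      (fun z => l z - h u) @^-1` [set t | `|sfrac t| < 16^-1]).
      apply: open_comp; last by apply: open_sfrac; lra.
      by move=> z _; apply: cvgB; [exact: cl|exact: cvg_cst].
    apply/seteqP; split => z; rewrite /U /=; congr (`|_| < _); apply: sfrac_eq.
      by rewrite opprB addrA subrK lrep.
    by rewrite -rpredN !opprB addrA subrK lrep.
  have nU : \forall w \near u, K w -> U (H w).
    have /subspace_continuousP/(_ u Ku) cHu := cH.
    have : nbhs (H u) U.
      apply: open_nbhs_nbhs; split => //.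
      by rewrite /U /= /h subrr sfrac_small normr0; lra.
    by move=> /cHu; rewrite /nbhs /= /within /= nearE.
  exists ([set w | K w -> U (H w)], [set w | K w -> U (H w)]) => //.
  move=> [y z] /= [hy hz] Ky Kz; have := hy Ky; have := hz Kz; rewrite /U /=.
  set a := sfrac (l (rep (H z)) - _).
  set b := sfrac (l (rep (H y)) - _) => ha hb.
  have hab : `|a - b| < 8^-1.
    move: ha hb; rewrite !ltr_norml => /andP[? ?] /andP[? ?].
    by apply/andP; split; lra.
  have -> : sfrac (h z - h y) = a - b; last by [].
  rewrite -(@sfrac_small _ (a - b)); last by apply: lt_trans hab _; lra.
  apply: sfrac_eq; rewrite [X in X \is a _](_ : _ =
     ((h z - h u) - a) - ((h y - h u) - b)); last by ring.
  exact: (rpredB (sfrac_int _) (sfrac_int _)).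
(* This [N] makes the mesh [1 / N] smaller than [e] and the increment [l v / N] smaller than 1/2,
   where [sfrac] is the identity. *)
pose N := (Num.truncn (e^-1 + 2 * `|l v|)).+1.
have Nbig : e^-1 + 2 * `|l v| < N%:R by exact: truncnS_gt.
have N0 : 0 < N%:R :> R by rewrite ltr0n.
have lv_ge0 : 0 <= `|l v| by [].
have ei0 : 0 < e^-1 by rewrite invr_gt0.
have Ne : N%:R^-1 < e by rewrite invf_plt ?posrE//; lra.
have Nlv : `|l v / N%:R| < 2^-1.
  by rewrite normrM normfV (gtr0_norm N0) ltr_pdivrMr//; lra.
pose t (i : nat) : R := i%:R / N%:R.
have t0 : t 0%N = 0 by rewrite /t mul0r.
have tN : t N = 1 by rewrite /t divff ?gt_eqF.
have tS i : t i.+1 = t i + N%:R^-1 by rewrite /t -natr1 mulrDl mul1r.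
have t01 i : (i <= N)%N -> t i \in `[0, 1].
  move=> iN; rewrite in_itv /= divr_ge0 ?ler0n//=.
  by rewrite ler_pdivrMr// mul1r ler_nat.
have tK i j : (i <= N)%N -> (j <= N)%N -> K (t i, t j).
  by move=> iN jN; split; rewrite /=; apply: t01.
have tball i : ball (t i) e (t i.+1).
  rewrite /ball /= tS opprD addrA subrr add0r normrN gtr0_norm ?invr_gt0//.
have tball0 i : ball (t i) e (t i) by exact: ballxx.
pose hh i j := h (t i, t j).
have : \sum_(j < N) sfrac (hh 0%N j.+1 - hh 0%N j) =
       \sum_(j < N) sfrac (hh N j.+1 - hh N j).
  apply: winding_homotopy => [i j iN jN|i j iN jN|i iN].
  - exact: (he _ _ (tK _ _ iN (ltnW jN)) (tK _ _ iN jN)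
      (conj (tball0 i) (tball j))).
  - exact: (he _ _ (tK _ _ (ltnW iN) jN) (tK _ _ iN jN)
      (conj (tball i) (tball0 j))).
  - by rewrite /hh tN t0 /h (Hs _ (t01 _ iN)) subrr.
(* The row [s = 0] follows the line: its [N] increments [l v / N] add up to [l v]. *)
rewrite (eq_bigr (fun=> l v / N%:R)) => [|j _]; last first.
  rewrite -[RHS]sfrac_small//; apply: sfrac_eq.
  rewrite /hh /h t0 !H0 ?t01 ?(ltnW (ltn_ord j))//=.
  have -> : l v / N%:R = l (z0 + t j.+1 *: v) - l (z0 + t j *: v).
    by rewrite tS /l /= /GRing.scale /=; ring.
  rewrite [X in X \is a _](_ : _ =
    (l (rep (torus_proj L (z0 + t j.+1 *: v))) - l (z0 + t j.+1 *: v))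
    - (l (rep (torus_proj L (z0 + t j *: v))) - l (z0 + t j *: v))); last first.
    by ring.
  by rewrite rpredB ?lrep.
(* The row [s = 1] is constant and has winding number 0, which forces [l v = 0]. *)
rewrite [RHS]big1 => [|j _]; last first.
  rewrite /hh /h tN !H1 ?t01 ?(ltnW (ltn_ord j))// subrr.
  by rewrite sfrac_small ?normr0; lra.
rewrite sumr_const card_ord -[_ *+ N]mulr_natr divfK ?gt_eqF// => lv00.
by move: lv0; rewrite -/(l v) lv00 eqxx.
Qed.

End noncontractible.

(** * Continuous functions on the torus *)

Section torus_functions.
Context {R : realType}.
Variable L : lattice R.
Local Notation b1 := (basis1 L).
Local Notation b2 := (basis2 L).
Local Notation cov := (fun z => torus_proj L (lincomb b1 b2 z.1 z.2)).
Variable f : torus L -> R.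
Hypothesis cf : continuous f.

Lemma continuous_measurable_torus :
  measurable_fun setT (f : borel_torus L -> R).
Proof.
apply: (measurability _ (RGenOpens.measurableE R)) => _ [_ [a [b ->] <-]].
rewrite setTI; apply: sub_gen_smallest.
by move/continuousP: cf; apply; exact: itv_open.
Qed.

(** Cramer's rule. *)
Lemma lincomb_coord (u v z : R * R) : det2 u v != 0 ->
  z = lincomb u v (det2 z v / det2 u v) (det2 u z / det2 u v).
Proof.
case: u v z => [u1 u2] [v1 v2] [z1 z2]; rewrite /det2 /lincomb /= => d0.
by congr pair; field.
Qed.

Lemma cov_periodic (m n : int) (a b : R) :
  cov (m%:~R + a, n%:~R + b) = cov (a, b).
Proof.
by apply/projP; exists m, n; rewrite /lincomb; congr (_, _) => /=; ring.
Qed.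

(** The coordinates are reduced to their fractional parts. The closed square is taken for its
    compactness, which bounds continuous functions. *)
Lemma cov_surj (x : torus L) :
  exists2 z, (`[0, 1] `*` `[0, 1]) z & cov z = x.
Proof.
have [w <-] := torus_proj_surj x.
rewrite (lincomb_coord w (Defs.basis_free L)).
set a := _ / _; set b := _ / _.
have fr01 (c : R) : c - (Num.floor c)%:~R \in `[0, 1].
  have /andP[h1 h2] := floor_itv c; rewrite in_itv /= subr_ge0 h1 /=.
  by rewrite ltW// ltrBlDr addrC; move: h2; rewrite intrD.
exists (a - (Num.floor a)%:~R, b - (Num.floor b)%:~R).
  by split; exact: fr01.
rewrite -(cov_periodic (Num.floor a) (Num.floor b)) /=.
by rewrite ![_%:~R + _]addrC !subrK.
Qed.

Lemma continuous_cov : continuous cov.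
Proof.
have cl (p q : R) : continuous (fun w : R * R => w.1 * p + w.2 * q).
  move=> z; apply: cvgD; apply: cvgM; try exact: cvg_cst.
    exact: cvg_fst.
  exact: cvg_snd.
move=> z; apply: (@continuous_comp _ _ _ (fun w => lincomb b1 b2 w.1 w.2)).
  exact: (cvg_pair (cl b1.1 b2.1 z) (cl b1.2 b2.2 z)).
exact: continuous_proj.
Qed.

Lemma torus_bounded : exists M, forall x, `|f x| <= M.
Proof.
have cK : compact (`[0, 1] `*` `[0, 1] : set (R * R)).
  by apply: compact_setX; exact: segment_compact.
have cfK : compact ((f \o cov) @` (`[0, 1] `*` `[0, 1])).
  apply: continuous_compact => //; apply: continuous_subspaceT => z.
  by apply: continuous_comp; [exact: continuous_cov | exact: cf].
have [M [_ /(_ (M + 1))]] := compact_bounded cfK.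
rewrite ltrDl => /(_ ltr01) fM; exists (M + 1) => x.
by have [z Kz <-] := cov_surj x; apply: fM; exists z.
Qed.

Lemma torus_areaT : torus_area L setT = (coarea L)%:E.
Proof.
rewrite -[LHS]mul1e -integral_cst//.
rewrite torus_integral//.
rewrite integral_cst//; last by apply: measurableX; exact: measurable_itv.
rewrite mul1e.
by rewrite -[RHS]mule1 -(@unit_square_area R).
Qed.

End torus_functions.

(** * The systole and the mean of the conformal factor *)

Section systole.
Context {R : realType}.
Variable L : lattice R.
Local Notation b1 := (basis1 L).
Local Notation b2 := (basis2 L).
Variable f : torus L -> R.
Hypothesis f0 : forall x, 0 < f x.

Lemma loop_length_ge0 (c : R -> R * R) : 0 <= loop_length f c.
Proof.
apply: Rintegral_ge0 => t _; apply: mulr_ge0; first exact: ltW.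
exact: sqrtr_ge0.
Qed.

Lemma sys_ge0 : 0 <= sys f.
Proof.
rewrite /sys; set S := (X in inf X); have [S0|S0] := pselect (S !=set0).
  by apply: lb_le_inf => // _ [c _ <-]; exact: loop_length_ge0.
(* Over the empty set, [inf] has the default value 0. *)
by rewrite inf_out// => -[].
Qed.

Lemma sys_le_loop_length (c : R -> R * R) :
  noncontractible_loop L c -> sys f <= loop_length f c.
Proof.
move=> nc; apply: ge_inf; last by exists c.
by exists 0 => _ [c' _ <-]; exact: loop_length_ge0.
Qed.

Lemma derive1_line (z v : R * R) (t : R) :
  derivable (fun t : R => z + t *: v) t 1 /\
  derive1 (fun t : R => z + t *: v) t = v.
Proof.
set g := fun _ : R => _.
have H : h^-1 *: ((g \o shift t) (h *: (1 : R)) - g t) @[h --> 0^'] --> v.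
  apply: cvg_near_cst; near=> h.
  rewrite /g /= [h *: 1]mulr1 opprD addrACA subrr add0r -scalerBl addrK.
  by rewrite scalerA mulVf ?scale1r//; near: h; exact: nbhs_dnbhs_neq.
split; first by apply/cvg_ex; exists v.
by rewrite derive1E; exact: cvg_lim.
Unshelve. all: by end_near. Qed.

(** The two coordinate forms dual to the basis are integral on the lattice, and one of them is
    nonzero at [v]; it detects the loop. *)
Lemma noncontractible_line_loop (z v : R * R) :
  lattice_set L v -> v != 0 -> noncontractible_loop L (fun t => z + t *: v).
Proof.
move=> Lv v0; split.
- exists [:: 1]; split => //=; first by rewrite ltr01.
  move=> [|//] _; exists (fun t => z + t *: v); split => //.
  + by move=> t; have [] := derive1_line z v t.
  + rewrite (_ : derive1 _ = cst v); first exact: cst_continuous.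
    by apply/funext => t; have [] := derive1_line z v t.
- apply/projP; move: Lv => [m [n ->]]; exists (- m), (- n).
  rewrite scale0r scale1r addr0 opprD addrA subrr add0r /lincomb !rmorphN.
  by congr (_, _) => /=; ring.
- have D0 := Defs.basis_free L; set D := det2 b1 b2 in D0.
  pose k := det2 v b2 / D; pose l := det2 b1 v / D.
  have vE := lincomb_coord v D0.
  have [k0|k0] := eqVneq k 0.
    (* The form [z |-> det2 b1 z / D], the second coordinate. *)
    apply: (@noncontractible_line _ L (- b1.2 / D) (b1.1 / D)).
      move=> _ [m [n ->]]; rewrite [X in X \is a _](_ : _ = n%:~R) ?intr_int//.
      by rewrite /lincomb/=; rewrite /D /det2 in D0 *; field; exact: D0.
    rewrite [X in X != 0](_ : _ = l); last by rewrite /l /det2; ring.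
    apply: contraNneq v0 => l0.
    by rewrite vE -/k -/l k0 l0 /lincomb !mul0r addr0.
  (* The form [z |-> det2 z b2 / D], the first coordinate. *)
  apply: (@noncontractible_line _ L (b2.2 / D) (- b2.1 / D)).
    move=> _ [m [n ->]]; rewrite [X in X \is a _](_ : _ = m%:~R) ?intr_int//.
    by rewrite /lincomb/=; rewrite /D /det2 in D0 *; field; exact: D0.
  by rewrite [X in X != 0](_ : _ = k)//; rewrite /k /det2; ring.
Qed.

End systole.

Section systole_mean.
Context {R : realType}.
Variable L : lattice R.
Local Notation mu := (@lebesgue_measure R).
Local Notation mu2 := (mu \x mu)%E.
Local Notation mline := (measurableTypeR R).
Local Notation mplane := (measurableTypeR R * measurableTypeR R)%type.
Local Notation b1 := (basis1 L).
Local Notation b2 := (basis2 L).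
Local Notation cov := (fun z => torus_proj L (lincomb b1 b2 z.1 z.2)).
Variable f : torus L -> R.
Hypotheses (cf : continuous f) (f0 : forall x, 0 < f x).

Lemma torus_integrable (g : torus L -> R) :
  continuous g -> (torus_area L).-integrable setT (EFin \o g).
Proof.
move=> cg; apply: (measurable_bounded_integrable measurableT).
- have aoo : (torus_area L setT < +oo)%E by rewrite torus_areaT ltry.
  exact: aoo.
- exact: continuous_measurable_torus.
- have [M gM] := torus_bounded cg.
  exists M; split; first exact: num_real.
  by move=> r Mr x _ /=; exact: le_trans (gM x) (ltW Mr).
Qed.

Let G (z : mplane) : \bar R := (f (cov z))%:E.

Lemma measurable_cov :
  measurable_fun setT (fun z : mplane => cov z : borel_torus L).
Proof.
have mp : measurable_fun setT (torus_proj L : mplane -> borel_torus L).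
  exact: measurable_proj.
exact: measurableT_comp mp (scales_area_lincomb (Defs.basis_free L)).1.
Qed.

Let mG : measurable_fun setT G.
Proof.
apply/measurable_EFinP.
exact: (measurableT_comp (continuous_measurable_torus cf) measurable_cov).
Qed.

Let G0 z : (0 <= G z)%E.
Proof. by rewrite lee_fin ltW. Qed.

Lemma sys_le_mean (v : R * R) : coarea L = 1 -> lattice_set L v -> v != 0 ->
  sys f <= enorm v * torus_mean f.
Proof.
move=> L1 Lv v0; have [k [l vE]] := Lv.
pose kr : R := k%:~R; pose lr : R := l%:~R.
have mI : measurable (`[0, 1]%classic : set mline) by exact: measurable_itv.
have mUS : measurable (unit_square : set mplane).
  by apply: measurableX; exact: measurable_itv.
(* In lattice coordinates [v] is [(kr, lr)], so [F (z, t)] is the conformal factor at time [t] on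
   the line from [z] in direction [v]. *)
pose F (w : mplane * mline) : \bar R := G (w.1.1 + w.2 * kr, w.1.2 + w.2 * lr).
have mF : measurable_fun setT F.
  have mw : measurable_fun setT (fun w : mplane * mline =>
      (w.1.1 + w.2 * kr, w.1.2 + w.2 * lr) : mplane).
    apply/measurable_fun_pairP; split; apply: measurable_funD => /=.
    - exact: (measurableT_comp measurable_fst measurable_fst).
    - by apply: measurable_funM => //; exact: measurable_snd.
    - exact: (measurableT_comp measurable_snd measurable_fst).
    - by apply: measurable_funM => //; exact: measurable_snd.
  exact: measurableT_comp mG mw.
have F0 w : (0 <= F w)%E by exact: G0.
have meanE : (\int[mu2]_(z in unit_square) G z)%E = (torus_mean f)%:E.
  have mf : measurable_fun setT (EFin \o f : borel_torus L -> \bar R).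
    by apply/measurable_EFinP; exact: (continuous_measurable_torus cf).
  have fE0 x : (0 <= (EFin \o f) x)%E by rewrite lee_fin ltW.
  have := torus_integral mf fE0; rewrite L1 mul1e => <-.
  rewrite /torus_mean /Rintegral fineK//.
  exact: (integrable_fin_num measurableT (torus_integrable cf)).
have sysz (z : mplane) :
    ((sys f)%:E <= (enorm v)%:E * \int[mu]_(t in `[0%R, 1%R]) F (z, t))%E.
  pose c (t : R) := lincomb b1 b2 z.1 z.2 + t *: v.
  have cE t : cov (z.1 + t * kr, z.2 + t * lr) = torus_proj L (c t).
    congr (torus_proj L _); rewrite /c vE.
    by congr (_, _) => /=; rewrite /GRing.scale /= -/kr -/lr; ring.
  have Fz0 t : (0 <= F (z, t))%E by [].
  have v_ge0 : (0 <= (enorm v)%:E)%E by rewrite lee_fin sqrtr_ge0.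
  have mFz : measurable_fun setT (fun t : mline => F (z, t)).
    exact: measurable_fun_pair2.
  rewrite -(ge0_integralZl mu mI (measurable_funTS mFz) (fun t _ => Fz0 t)
    v_ge0).
  have : (sys f <= loop_length f c).
    by apply: sys_le_loop_length => //; exact: noncontractible_line_loop.
  rewrite -lee_fin => /le_trans; apply.
  rewrite /loop_length /Rintegral.
  rewrite [X in (fine X)%:E](_ : _ =
    \int[mu]_(t in `[0%R, 1%R]) ((enorm v)%:E * F (z, t)))%E; last first.
    apply: eq_integral => t _.
    by rewrite (derive1_line _ _ t).2 /F /G /= cE -EFinM mulrC.
  set I := (\int[mu]_(t in _) _)%E.
  (* For nonnegative [I] one has [fine I <= I], also when [I] is infinite and [fine I] is 0. *)
  have : (0 <= I)%E by apply: integral_ge0 => t _; rewrite mule_ge0.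
  by case: I => [r| |]//= _; rewrite leey.
have sys_int : (\int[mu2]_(z in unit_square) (sys f)%:E = (sys f)%:E)%E.
  transitivity ((sys f)%:E * mu2 unit_square)%E; first exact: integral_cst.
  by rewrite unit_square_area mule1.
rewrite -lee_fin -sys_int EFinM -meanE.
have Fint : (\int[mu2]_(z in unit_square) \int[mu]_(t in `[0%R, 1%R]) F (z, t) =
   \int[mu2]_(z in unit_square) G z)%E.
  have <- := @fubini_tonelli1_setX _ _ mplane mline R lebesgue_plane mu _ _ _
    mUS mI mF F0.
  have -> := @fubini_tonelli2_setX _ _ mplane mline R lebesgue_plane mu _ _ _
    mUS mI mF F0.
  (* With the order of integration exchanged, the inner integral at fixed [t] is that of [G]
     translated by [t] times [(kr, lr)], and periodicity removes the translation. *)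
  transitivity
    (\int[mu]_(t in `[0%R, 1%R]) (\int[mu2]_(z in unit_square) G z))%E.
    apply: eq_integral => t _.
    rewrite -(ge0_integral_periodic2 (t * kr) (t * lr) mG G0).
    - by apply: eq_integral => z _; rewrite /F /= ![_ * _ + _]addrC.
    - by move=> x y; rewrite /G -[y in LHS]add0r (cov_periodic L 1 0).
    - by move=> x y; rewrite /G -[x in LHS]add0r (cov_periodic L 0 1).
  set I := (\int[mu2]_(z in _) _)%E.
  transitivity (I * mu `[0%R, 1%R])%E; first exact: integral_cst.
  by rewrite lebesgue_measure_itv /= lte_fin ltr01 -EFinD subr0 mule1.
rewrite -Fint.
have mFt := measurable_fubini_tonelli_setX mu mI mF F0.
have Ft0 z : (0 <= \int[mu]_(t in `[0%R, 1%R]) F (z, t))%E.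
  by apply: integral_ge0.
have v_ge0 : (0 <= (enorm v)%:E)%E by rewrite lee_fin sqrtr_ge0.
rewrite -(ge0_integralZl mu2 mUS (measurable_funTS mFt) (fun z _ => Ft0 z)
  v_ge0).
have mvFt : measurable_fun unit_square (fun z : mplane =>
    (enorm v)%:E * \int[mu]_(t in `[0%R, 1%R]) F (z, t))%E.
  by apply: measurable_funTS; exact: measurable_funeM.
apply: (ge0_le_integral mu2 mUS _ _ mvFt (fun z _ => sysz z)).
- by move=> z _; rewrite lee_fin sys_ge0.
- exact: measurable_cst.
Qed.

End systole_mean.

(** * Variance of the conformal factor *)

Section variance.
Context {R : realType}.
Variable L : lattice R.
Variable f : torus L -> R.
Hypothesis cf : continuous f.

(** The square in the variance is expanded; the constant [m ^+ 2] integrates to itself because the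
    total mass is [coarea L = 1]. *)
Lemma area_sub_variance : coarea L = 1 ->
  area f - torus_variance f = torus_mean f ^+ 2.
Proof.
move=> L1; set m := torus_mean f.
have cf2 : continuous (fun x => f x ^+ 2).
  by move=> x; exact: (cvgM (@cf x) (@cf x)).
have cmf : continuous (fun x => 2 * m * f x).
  by move=> x; exact: (cvgM (cvg_cst _) (@cf x)).
have cd : continuous (fun x => f x ^+ 2 - 2 * m * f x).
  by move=> x; exact: (cvgB (@cf2 x) (@cmf x)).
have cm : continuous (fun _ : torus L => m ^+ 2 : R) by exact: cst_continuous.
have -> : torus_variance f =
    \int[torus_area L]_x ((f x ^+ 2 - 2 * m * f x) + m ^+ 2).
  by apply: eq_Rintegral => x _; rewrite -/m; ring.
rewrite (RintegralD measurableT (torus_integrable cd) (torus_integrable cm)).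
rewrite (RintegralB measurableT (torus_integrable cf2) (torus_integrable cmf)).
rewrite (RintegralZl _ measurableT (torus_integrable cf)).
have -> : \int[torus_area L]_x (m ^+ 2) = m ^+ 2.
  transitivity (m ^+ 2 * fine (torus_area L setT)); first exact: Rintegral_cst.
  by rewrite torus_areaT L1 mulr1.
by transitivity (area f - (area f - 2 * m * m + m ^+ 2)); [|ring].
Qed.

End variance.

(** * A short vector in a rectangular lattice *)

Section short_vector.
Context {R : realType}.
Implicit Types (z tau : R * R).

Lemma closure_fundamental_domain tau :
  closure fundamental_domain tau -> 1 <= tau.1 ^+ 2 + tau.2 ^+ 2 /\ 0 <= tau.2.
Proof.
pose A : set (R * R) := (fun z => z.1 ^+ 2 + z.2 ^+ 2) @^-1` [set x | 1 <= x].
pose B : set (R * R) := (fun z => z.2) @^-1` [set x | 0 <= x].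
suff cAB : closed (A `&` B).
  have DAB : (@fundamental_domain R) `<=` A `&` B.
    move=> z [z1 _ z2]; split; last exact: ltW.
    rewrite /A /=; move: z1; rewrite /enorm => z1.
    have := ltW z1; rewrite -[X in X <= _]sqrtr1 ler_sqrt//.
    by rewrite addr_ge0 ?sqr_ge0.
  by move=> /(closure_subset DAB); rewrite -(closure_id _).1// => -[].
apply: closedI; apply: closed_comp.
- move=> z _; apply: cvgD; apply: cvgM; by [exact: cvg_fst|exact: cvg_snd].
- exact: closed_ge.
- move=> z _; exact: cvg_snd.
- exact: closed_ge.
Qed.

Lemma enorm_sqr z : enorm z ^+ 2 = z.1 ^+ 2 + z.2 ^+ 2.
Proof. by rewrite sqr_sqrtr// addr_ge0 ?sqr_ge0. Qed.

(** [k] is the determinant of the integer matrix expressing [w] and [z] in terms of [u] and [v]. *)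
Lemma det2_Zspan (u v w z : R * R) : Zspan u v w -> Zspan u v z ->
  exists k : int, det2 w z = k%:~R * det2 u v.
Proof.
move=> [a [b ->]] [c [d ->]]; exists (a * d - b * c).
by rewrite rmorphB !rmorphM /det2 /lincomb /=; ring.
Qed.

Lemma rectangular_short_vector (L : lattice R) tau :
  coarea L = 1 -> closure fundamental_domain tau ->
  plane_similar (lattice_set L) (Zspan tau (1, 0)) -> tau.1 = 0 ->
  exists v, [/\ lattice_set L v, v != 0 & enorm v <= 1].
Proof.
move=> L1 /closure_fundamental_domain[tau1 tau2] [r [S [r0 Sr LS]]] t10.
have {}tau2 : 1 <= tau.2.
  move: tau1; rewrite t10 expr0n add0r -[X in X <= _](expr1n _ 2).
  by rewrite ler_sqr// nnegrE.
pose p := S (1, 0); pose q := S (0, 1).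
have tauE : tau = tau.2 *: (0, 1).
  rewrite [LHS]surjective_pairing t10.
  by congr (_, _); rewrite /GRing.scale /= ?mulr0 ?mulr1.
have StauE : S tau = tau.2 *: q by rewrite [in LHS]tauE linearZ.
have LE : lattice_set L = Zspan (S tau) p.
  have Slin (a b : R) : S (lincomb tau (1, 0) a b) = lincomb (S tau) p a b.
    by rewrite -[lincomb tau _ _ _]/(a *: tau + b *: (1, 0)) linearD !linearZ.
  rewrite LS; apply/seteqP; split => z.
    by move=> [_ [m [n ->]] <-]; exists m, n.
  by move=> [m [n ->]]; exists (lincomb tau (1, 0) m%:~R n%:~R); [exists m, n|].
have np : enorm p = r by rewrite Sr /enorm /= expr1n expr0n addr0 sqrtr1 mulr1.
have nq : enorm q = r by rewrite Sr /enorm /= expr1n expr0n add0r sqrtr1 mulr1.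
(* Polarization: together with the lengths of [p] and [q] this gives their orthogonality [dot0]. *)
have npq : enorm (p + q) ^+ 2 = r ^+ 2 * 2.
  rewrite -linearD Sr exprMn enorm_sqr /= addr0 add0r expr1n.
  by congr (_ * _); ring.
have Zspan1 (u v : R * R) : Zspan u v u.
  exists 1, 0; rewrite /lincomb !mul0r !addr0 !mul1r; exact: surjective_pairing.
have Zspan2 (u v : R * R) : Zspan u v v.
  exists 0, 1; rewrite /lincomb !mul0r !add0r !mul1r; exact: surjective_pairing.
have pL : lattice_set L p by rewrite LE; exact: Zspan2.
exists p; split => //.
  apply: contraTneq r0 => p0.
  by rewrite -np p0 /enorm /= expr0n addr0 sqrtr0 ltxx.
have b1L : Zspan (S tau) p (basis1 L) by rewrite -LE; exact: Zspan1.
have b2L : Zspan (S tau) p (basis2 L) by rewrite -LE; exact: Zspan2.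
have [k kE] := det2_Zspan b1L b2L.
have ndet : `|det2 q p| = r ^+ 2.
  apply/eqP; rewrite -(@eqrXn2 _ 2) ?sqr_ge0// real_normK ?num_real//.
  apply/eqP.
  have dot0 : p.1 * q.1 + p.2 * q.2 = 0.
    move: npq (enorm_sqr p) (enorm_sqr q); rewrite enorm_sqr np nq /=; nra.
  rewrite -[in RHS]np enorm_sqr.
  (* Lagrange's identity. *)
  transitivity ((p.1 ^+ 2 + p.2 ^+ 2) * (q.1 ^+ 2 + q.2 ^+ 2) -
                (p.1 * q.1 + p.2 * q.2) ^+ 2).
    by rewrite /det2; ring.
  by rewrite dot0 -(enorm_sqr q) nq -np enorm_sqr; ring.
have dS : det2 (S tau) p = tau.2 * det2 q p.
  by rewrite StauE /det2 /=; rewrite /GRing.scale /=; ring.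
have k0 : k%:~R != 0 :> R.
  apply: contra_eq_neq L1 => k0.
  by rewrite /coarea kE k0 mul0r normr0 eq_sym oner_neq0.
have k1 : 1 <= `|k%:~R : R| by apply: norm_intr_ge1 => //; exact: intr_int.
(* The coarea 1 is [|k|] times the area of the rectangle with sides [S tau] and [p]; as [|k|] and
   [tau.2] are at least 1, [r ^+ 2 <= 1]. *)
have E : `|k%:~R : R| * (tau.2 * r ^+ 2) = 1.
  transitivity (coarea L); last by [].
  by rewrite /coarea kE dS !normrM ndet (ger0_norm (le_trans ler01 tau2)) //.
rewrite np -(@ler_sqr _ r 1) ?nnegrE ?(ltW r0)// expr1n.
have r20 : 0 <= r ^+ 2 by rewrite sqr_ge0.
apply: (@le_trans _ _ (tau.2 * r ^+ 2)); first by rewrite ler_peMl.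
by rewrite -E ler_peMl// mulr_ge0// (le_trans ler01).
Qed.

End short_vector.

Theorem corollary4p3 (R : realType) (L : lattice R) (tau : R * R)
    (f : torus L -> R) :
  coarea L = 1 ->
  closure fundamental_domain tau ->
  plane_similar (lattice_set L) (Zspan tau (1, 0)) ->
  tau.1 = 0 ->
  continuous f ->
  (forall x, 0 < f x) ->
  area f - sys f ^+ 2 >= torus_variance f.
Proof.
move=> L1 ctau sim tau0 cf f0.
have [v [Lv v0 v1]] := rectangular_short_vector L1 ctau sim tau0.
have m0 : 0 <= torus_mean f by apply: Rintegral_ge0 => x _; exact: ltW.
have sm : sys f <= torus_mean f.
  apply: le_trans (sys_le_mean cf f0 L1 Lv v0) _; exact: ler_piMl.
have : sys f ^+ 2 <= torus_mean f ^+ 2 by rewrite ler_sqr// nnegrE// sys_ge0.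
have := area_sub_variance cf L1; lra.
Qed.
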